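(* Let $(\mathbb{S},\Sigma)$ be a measurable space, $\mu\in\mathcal{M}(\mathbb{S})$, $f\in L^1(\mathbb{S};\mu)$, and let $\{f^{(n)}\}_{n=1,2,\ldots}\subset L^1(\mathbb{S};\mu)$ be a sequence of nonnegative functions. Then the inequality $$\liminf_{n\to\infty}\ \inf_{S\in\Sigma}\left(\int_S f^{(n)}(s)\,\mu(ds)-\int_S f(s)\,\mu(ds)\right)\ge 0$$ holds if and only if for each $\varepsilon>0$ $$\mu(\{s\in\mathbb{S}: f^{(n)}(s)\le f(s)-\varepsilon\})\to 0\quad\text{as } n\to\infty,$$ and, therefore (as a consequence of this convergence), there exists a subsequence $\{f^{(n_k)}\}_{k=1,2,\ldots}$ of $\{f^{(n)}\}_{n=1,2,\ldots}$ such that $\liminf_{k\to\infty} f^{(n_k)}(s)\ge f(s)$ for $\mu$-a.e. $s\in\mathbb{S}$.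
   Context: $\mathcal{M}(\mathbb{S})$ is the family of finite (nonnegative) measures on $(\mathbb{S},\Sigma)$. Functions $f:\mathbb{S}\to\overline{\mathbb{R}}:=\mathbb{R}\cup\{\pm\infty\}$ are called measurable if $\{s\in\mathbb{S}: f(s)<\alpha\}\in\Sigma$ for each $\alpha\in\mathbb{R}$. $L^1(\mathbb{S};\mu)$ is the set of all measurable functions $g:\mathbb{S}\to\overline{\mathbb{R}}$ with $\int_{\mathbb{S}}|g(s)|\,\mu(ds)<+\infty$. *)

(* Defs.v *)
From HB Require Import structures.
From mathcomp Require Export all_boot all_order all_algebra.
From mathcomp Require Export all_classical all_reals all_analysis.
Export Order.TTheory GRing.Theory Num.Theory.
Export numFieldNormedType.Exports.

#[export] Set Implicit Arguments.
#[export] Unset Strict Implicit.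
#[export] Unset Printing Implicit Defensive.

(* Main.v *)
Require Import Defs.
From mathcomp Require Import all_boot all_order all_algebra.
From mathcomp Require Import all_classical all_reals all_analysis.
From mathcomp Require Import measurable_realfun.

(** Write A_n(e) for the bad set where f_n <= f - e.

    If the infimum over S of the differences of integrals has a nonnegative
    lower limit, then testing it on S = A_n(e) gives the claim: there f exceeds
    f_n by at least e, so the difference is at most - e * mu (A_n(e))
    ([le_integral_gap]), and mu (A_n(e)) must tend to 0.

    Conversely, since f_n >= 0, the pointwise bound
    f <= f_n + e + |f| 1_{A_n(e)} holds everywhere, so for every S the integral
    of f over S exceeds that of f_n by at most
    e * mu S + \int_{A_n(e)} |f| ([le_integral_shortfall]).
    This bound is uniform in S: the first term is small because mu is finite,
    the second because the integral of |f| is absolutely continuous with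
    respect to mu ([integral_abse_continuous]) and mu (A_n(e)) tends to 0.

    The subsequence comes from the Borel-Cantelli lemma applied to the sets
    A_{phi k}(1 / (k + 1)), with phi growing fast enough for their measures to
    be summable ([ae_ge_limn_einf_subseq]). *)

Local Open Scope classical_set_scope.
Local Open Scope ring_scope.
Local Open Scope ereal_scope.

(** [l] will be a value of an extended-real function: at an infinite [l] the
    hypothesis reads [l <= u n], as [l - e = l]. *)
Lemma le_limn_einf (R : realType) (u : (\bar R)^nat) (l : \bar R) :
  (forall e : R, (0 < e)%R -> \forall n \near \oo, l - e%:E <= u n) ->
  l <= limn_einf u.
Proof.
move=> lu; rewrite limn_einf_lim; apply/lee_addgt0Pr => e e0.
rewrite -leeBlDr//; apply: lime_ge; first exact: is_cvg_einfs.
have [N _ Nu] := lu e e0; exists N => // n /= Nn.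
apply: le_ereal_inf_tmp => _ [m /= nm <-].
exact/Nu/(leq_trans Nn).
Qed.

(** A partial converse, which fails at [l = +oo]: a sequence of reals may tend
    to [+oo], whereas [+oo - e = +oo]. *)
Lemma limn_einf_ge_near (R : realType) (u : (\bar R)^nat) (l : \bar R) :
  l \is a fin_num -> l <= limn_einf u ->
  forall e : R, (0 < e)%R -> \forall n \near \oo, l - e%:E <= u n.
Proof.
move=> lfin lu e e0.
have : l - e%:E < limn_einf u.
  by apply: lt_le_trans lu; rewrite lteBlDr// lteDl// lte_fin.
rewrite limn_einf_lim (cvg_lim _ (@cvg_einfs_sup R u))//.
move=> /ereal_sup_gt[_ [N _ <-] lN]; exists N => // n /= Nn.
by apply/ltW/(lt_le_trans lN)/ereal_inf_lbound; exists n.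
Qed.

Lemma ge0_cvge0P (R : realType) (u : (\bar R)^nat) : (forall n, 0 <= u n) ->
  u @ \oo --> 0 <->
  forall e : R, (0 < e)%R -> \forall n \near \oo, u n <= e%:E.
Proof.
move=> u0; split=> [/fine_cvgP[ufin /cvgrPdist_le ucvg] e e0|ucvg].
  apply: filterS2 ufin (ucvg e e0) => n un.
  by rewrite sub0r normrN ger0_norm ?fine_ge0//= -lee_fin fineK.
apply/fine_cvgP; split.
  have := ucvg _ ltr01; apply: filterS => n un.
  by rewrite ge0_fin_numE// (le_lt_trans un) ?ltry.
apply/cvgrPdist_le => e e0; have := ucvg e e0; apply: filterS => n un.
rewrite sub0r normrN ger0_norm ?fine_ge0//= -lee_fin fineK//.
by rewrite ge0_fin_numE// (le_lt_trans un) ?ltry.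
Qed.

(** The finite measure [A |-> \int_A |f|] is dominated by [mu], and for a finite
    measure domination amounts to this epsilon-delta condition. *)
Lemma integral_abse_continuous d (T : measurableType d) (R : realType)
    (mu : {measure set T -> \bar R}) (f : T -> \bar R) (e : R) :
  mu.-integrable setT f -> (0 < e)%R ->
  exists2 r : R, (0 < r)%R & forall A, measurable A -> mu A < r%:E ->
    \int[mu]_(x in A) `|f x| < e%:E.
Proof.
move=> intf e0; have intnf := integrable_abse intf.
have [P [N PN]] := Hahn_decomposition (induced_charge intnf).
have [r [r0 re]] := charge_variation_continuous PN (dominates_induced intf) e0.
exists r => // A mA Ar; apply: le_lt_trans (re _ mA Ar).
exact: le_trans (lee_abs _) (abse_charge_variation _ _).
Qed.

(** Along a fast enough subsequence the exceptional sets, taken with thresholds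
    shrinking to 0, have summable measures. By Borel-Cantelli almost every point
    lies in finitely many of them, so the inequality is eventually violated by
    less than any given threshold. *)
Lemma ae_ge_limn_einf_subseq d (T : measurableType d) (R : realType)
    (mu : {measure set T -> \bar R}) (f : T -> \bar R) (g : (T -> \bar R)^nat) :
  measurable_fun setT f -> (forall n, measurable_fun setT (g n)) ->
  (forall e : R, (0 < e)%R ->
    mu [set s | g n s <= f s - e%:E] @[n --> \oo] --> 0) ->
  exists phi : nat -> nat, increasing_seq phi /\
    {ae mu, forall s, f s <= limn_einf (fun k => g (phi k) s)}.
Proof.
move=> mf mg fg.
pose A (k n : nat) := [set s | g n s <= f s - k.+1%:R^-1%:E].
have mA k n : measurable (A k n).
  rewrite -[A k n]setTI; apply: measurable_lee => //.
  by apply: emeasurable_funB => //; exact: measurable_cst.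
have /choice[N AN] k : exists N, forall n, (N <= n)%N ->
    mu (A k n) <= (1 / (2 ^ k.+1)%:R)%:E.
  have k0 : (0 < k.+1%:R^-1 :> R)%R by [].
  have /ge0_cvge0P := fg _ k0.
  move=> /(_ (fun n => measure_ge0 _ _))/(_ (1 / (2 ^ k.+1)%:R)%R).
  by rewrite divr_gt0// ?ltr0n ?expn_gt0// => /(_ isT)[N _ AN]; exists N.
(* Adding up the successors of the N i makes phi strictly increasing while
   keeping phi k >= N k. *)
pose phi k := (\sum_(i < k.+1) (N i).+1)%N.
have Nphi k : (N k <= phi k)%N.
  by rewrite /phi big_ord_recr/= (leq_trans (leqnSn _))// leq_addl.
exists phi; split.
  apply/increasing_seqP => k.
  by rewrite /phi [ltRHS]big_ord_recr/= ltEnat/= addnS ltnS leq_addr.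
exists (lim_sup_set (fun k => A k (phi k))); split.
- by apply: bigcap_measurable => // k _; exact: bigcup_measurable.
- apply: lim_sup_set_cvg0 => //.
  apply: (@le_lt_trans _ _ (\sum_(k <oo) (1 / (2 ^ k.+1)%:R)%:E)).
    by apply: lee_nneseries => // k _; exact: AN.
  exact: le_lt_trans (epsilon_trick0 _ ler01) (ltry _).
- move=> s /=; apply: contra_notP => sN.
  have {sN}[n _ sA] : exists2 n, True & forall j, (n <= j)%N -> ~ A j (phi j) s.
    apply: contra_notP sN => /forall2NP sN n _.
    have [//|/existsNP[j /not_implyP[nj /contrapT Aj]]] := sN n.
    by exists j.
  apply: le_limn_einf => e e0.
  have [m _ me] : \forall k \near \oo, (k.+1%:R^-1 <= e)%R.
    have := near_infty_natSinv_lt (PosNum e0).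
    by apply: filterS => k /ltW.
  exists (maxn n m) => // k /=; rewrite geq_max => /andP[nk mk].
  have /negP := sA _ nk; rewrite /A /= -ltNge => /ltW; apply: le_trans.
  by apply: leeD2l; rewrite lee_fin lerN2; exact: me.
Qed.

(** Off [A] one has [f <= g + e]; on [A] nonnegativity of [g] leaves
    [f <= |f| <= g + e + |f|]. The error term does not see [S] beyond [mu S],
    whence the uniformity in [S]. *)
Lemma le_integral_shortfall d (T : measurableType d) (R : realType)
    (mu : {finite_measure set T -> \bar R}) (f g : T -> \bar R) (e : R)
    (A := [set s | g s <= f s - e%:E]) (S : set T) :
  mu.-integrable setT f -> mu.-integrable setT g -> (forall s, 0 <= g s) ->
  (0 <= e)%R -> measurable S ->
  \int[mu]_(s in S) f s <=
    \int[mu]_(s in S) g s + e%:E * mu S + \int[mu]_(s in A) `|f s|.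
Proof.
move=> intf intg g0 e0 mS.
have mf := measurable_int _ intf.
have mA : measurable A.
  rewrite -[A]setTI; apply: measurable_lee => //.
    exact: measurable_int intg.
  by apply: emeasurable_funB => //; exact: measurable_cst.
have intfS := integrableS measurableT mS (@subsetT _ _) intf.
have intgS := integrableS measurableT mS (@subsetT _ _) intg.
have inteS := finite_measure_integrable_cst mu e mS.
have intfA : mu.-integrable S ((abse \o f) \_ A).
  apply/integrable_restrict => //.
  apply: (integrableS measurableT) => //; first exact: measurableI.
  exact: integrable_abse.
rewrite -integral_cst//.
apply: (@le_trans _ _ (\int[mu]_(s in S)
    (g s + (EFin \o cst e) s + ((abse \o f) \_ A) s))).
  apply: le_integral => //.
    by apply: integrableD => //; exact: integrableD.
  move=> s _; rewrite patchE /=; case: ifPn => [sA|/negP sA].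
    by rewrite (le_trans (lee_abs _))// leeDr// adde_ge0.
  rewrite adde0 -leeBlDr// ltW// ltNge; apply/negP => sA'.
  by apply: sA; rewrite inE.
rewrite integralD//; last exact: integrableD.
rewrite integralD// leeD2l// -integral_mkcondr.
apply: ge0_subset_integral => //; first exact: measurableI.
  by apply: measurableT_comp => //; exact: measurable_funTS.
by move=> s _; exact: abse_ge0.
Qed.

Lemma le_integral_gap d (T : measurableType d) (R : realType)
    (mu : {finite_measure set T -> \bar R}) (f g : T -> \bar R) (e : R)
    (A : set T) :
  mu.-integrable A f -> mu.-integrable A g -> measurable A ->
  (forall s, A s -> g s <= f s - e%:E) ->
  \int[mu]_(s in A) g s <= \int[mu]_(s in A) f s - e%:E * mu A.
Proof.
move=> intf intg mA gf; rewrite -integral_cst// -integralB//; last first.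
  exact: finite_measure_integrable_cst.
apply: le_integral => //.
  by apply: integrableB => //; exact: finite_measure_integrable_cst.
by move=> s; rewrite inE => /gf.
Qed.

Theorem corollary1p6 (R : realType) (d : measure_display)
    (T : measurableType d) (mu : {finite_measure set T -> \bar R})
    (f : T -> \bar R) (f_ : nat -> T -> \bar R)
    (intf : mu.-integrable setT f)
    (intf_ : forall n, mu.-integrable setT (f_ n))
    (f_ge0 : forall n s, 0 <= f_ n s) :
  let conv_below :=
    forall eps : R, (0 < eps)%R ->
      mu [set s | f_ n s <= f s - eps%:E] @[n --> \oo] --> 0 in
  (0 <= limn_einf (fun n =>
          ereal_inf [set (\int[mu]_(s in S) f_ n s) - (\int[mu]_(s in S) f s)
                    | S in measurable])
   <-> conv_below)
  /\
  (conv_below ->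
   exists phi : nat -> nat, increasing_seq phi /\
     {ae mu, forall s, f s <= limn_einf (fun k => f_ (phi k) s)}).
Proof.
move=> conv_below.
have mf := measurable_int _ intf.
have mf_ n := measurable_int _ (intf_ n).
have mA e n : measurable [set s | f_ n s <= f s - e%:E].
  rewrite -[X in measurable X]setTI; apply: measurable_lee => //.
  by apply: emeasurable_funB => //; exact: measurable_cst.
split; last exact: ae_ge_limn_einf_subseq.
split=> [inf_ge0 eps eps0|cvA].
  apply/ge0_cvge0P => // delta delta0.
  (* The tolerance eps * delta turns eps * mu A <= eps * delta into
     mu A <= delta. *)
  have := limn_einf_ge_near (isT : 0 \is a fin_num) inf_ge0
    (mulr_gt0 eps0 delta0).
  apply: filterS => n; rewrite sub0e; set A := [set s | _ <= _].
  have mAn : measurable A by exact: mA.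
  have intfA := integrableS measurableT mAn (@subsetT _ _) intf.
  have intgA := integrableS measurableT mAn (@subsetT _ _) (intf_ n).
  have muA : mu A \is a fin_num by exact: fin_num_measure.
  have fA := integrable_fin_num mAn intfA.
  move=> /le_trans infA.
  have : - (eps * delta)%:E <= - (eps%:E * mu A).
    apply: infA.
    apply: (@le_trans _ _ (\int[mu]_(s in A) f_ n s - \int[mu]_(s in A) f s)).
      by apply: ereal_inf_lbound; exists A.
    rewrite leeBlDl//; exact: le_integral_gap.
  by rewrite leeN2 EFinM lee_pmul2l ?lte_fin.
apply: le_limn_einf => e e0.
have e20 : (0 < e / 2)%R by exact: divr_gt0.
have [r r0 fr] := integral_abse_continuous intf e20.
have muT : mu setT \is a fin_num by exact: fin_num_measure.
have muT0 : (0 < fine (mu setT) + 1)%R by rewrite ltr_wpDl// fine_ge0.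
(* This threshold makes eta * mu S <= e / 2 for every S; adding 1 to the total
   mass covers the zero measure. *)
pose eta := (e / 2 / (fine (mu setT) + 1))%R.
have eta0 : (0 < eta)%R by exact: divr_gt0.
have r20 : (0 < r / 2)%R by exact: divr_gt0.
have := (ge0_cvge0P (fun=> measure_ge0 _ _)).1 (cvA _ eta0) _ r20.
apply: filterS => n Ar; apply: le_ereal_inf_tmp => _ [S mS <-].
have intfS := integrableS measurableT mS (@subsetT _ _) intf.
have intgS := integrableS measurableT mS (@subsetT _ _) (intf_ n).
have fS := integrable_fin_num mS intfS.
have gS := integrable_fin_num mS intgS.
have muS : mu S \is a fin_num by exact: fin_num_measure.
rewrite sub0e leeBrDr// addeC leeBlDr//.
apply: le_trans (le_integral_shortfall intf (intf_ n) (f_ge0 n) (ltW eta0) mS) _.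
rewrite -addeA leeD2l// [e]Num.Theory.splitr EFinD leeD//.
  apply: (@le_trans _ _ (eta%:E * mu setT)).
    by rewrite lee_pmul2l ?lte_fin// le_measure ?inE.
  rewrite -(fineK muT) -EFinM lee_fin /eta mulrAC ler_pdivrMr//.
  by rewrite ler_pM2l// lerDl.
apply/ltW/fr; first exact: mA.
by rewrite (le_lt_trans Ar)// lte_fin ltr_pdivrMr// ltr_pMr// ltr1n.
Qed.
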